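(* There exist infinitely many solvable tetravalent $3$-arc-regular graphs.
   Context: All graphs are finite, simple and undirected. A graph $\Gamma$ is solvable if $\mathrm{Aut}(\Gamma)$ is a solvable group; tetravalent means regular of valency $4$. A $3$-arc is an ordered $4$-tuple $(v_0,v_1,v_2,v_3)$ of vertices with $v_{i-1}$ adjacent to $v_i$ for $1\le i\le 3$, $v_0\neq v_2$ and $v_1\ne v_3$. A graph is $3$-arc-regular if it is regular (as a graph) and its full automorphism group acts regularly (transitively with trivial stabilizers) on the set of its $3$-arcs. *)

(* Defs.v *)
From HB Require Import structures.
From mathcomp Require Import all_boot all_fingroup all_solvable.

Set Implicit Arguments.
Unset Strict Implicit.
Unset Printing Implicit Defensive.

Local Open Scope group_scope.

Record sgraph := SGraph {
  vertex :> finType;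
  adj : rel vertex;
  adj_sym : symmetric adj;
  adj_irr : irreflexive adj
}.

Definition graph_isomorphic (G H : sgraph) : Prop :=
  exists2 f : G -> H, bijective f & forall x y : G, adj (f x) (f y) = adj x y.

Definition valency (G : sgraph) (x : G) : nat := #|[set y : G | adj x y]|.

Definition regular_of_valency (G : sgraph) (k : nat) : Prop :=
  forall x : G, valency x = k.

Definition tetravalent (G : sgraph) : Prop := regular_of_valency G 4.

Definition graph_aut (G : sgraph) : {set {perm G}} :=
  [set s : {perm G} | [forall x : G, forall y : G, adj (s x) (s y) == adj x y]].

Lemma graph_aut_group_set (G : sgraph) : group_set (graph_aut G).
Proof.
apply/group_setP; split=> [|s t].
  by rewrite inE; apply/'forall_'forall_eqP=> x y; rewrite !perm1.
rewrite !inE => /'forall_'forall_eqP sP /'forall_'forall_eqP tP.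
by apply/'forall_'forall_eqP=> x y; rewrite !permM tP sP.
Qed.

Canonical graph_aut_group (G : sgraph) := Group (graph_aut_group_set G).

Definition solvable_graph (G : sgraph) : Prop := solvable (graph_aut G).

Definition is_three_arc (G : sgraph) (t : 4.-tuple G) : bool :=
  let v i := tnth t (inord i) in
  [&& adj (v 0) (v 1%N), adj (v 1%N) (v 2), adj (v 2) (v 3),
      v 0 != v 2 & v 1%N != v 3].

Definition three_arcs (G : sgraph) : {set 4.-tuple G} :=
  [set t : 4.-tuple G | is_three_arc t].

(* ['P * 4] is the componentwise action of permutations on 4-tuples. The     *)
(* library's transitivity predicate also requires the set acted on to be     *)
(* nonempty, so a graph without 3-arcs is not 3-arc-regular.                 *)
Definition three_arc_regular (G : sgraph) : Prop :=
  [/\ exists k, regular_of_valency G k,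
      [transitive graph_aut G, on three_arcs G | 'P * 4]
    & forall t, t \in three_arcs G -> 'C_(graph_aut G)[t | 'P * 4] = 1].

(* Main.v *)
Require Import Defs.
From HB Require Import structures.
From mathcomp Require Import all_boot all_fingroup all_solvable.
From mathcomp Require Import ssralg zmodp finalg integral_char.

Set Implicit Arguments.
Unset Strict Implicit.
Unset Printing Implicit Defensive.

Local Open Scope group_scope.

(** Let P be a finite group generated by two Klein four-groups A and B with
    trivial intersection.  In the coset graph of P the vertices are the left
    cosets of A and of B, and two cosets are adjacent when they meet; each
    element y of P is the common point of y A and y B, so the edges of the graph
    are the elements of P, and the graph is tetravalent.  If automorphisms of P
    rotate the three involutions of A, rotate those of B, and exchange A with
    B, then the graph is 3-arc-transitive.  It has 18 |P| three-arcs.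

    What must be shown is that an automorphism phi fixing a 3-arc is trivial.
    It induces a map f on P that turns a step y -> y a with a in A into another
    such step, but the new label may depend on y; likewise for B.  Suppose that
    P satisfies the relations (b a1 b a2 b a3)^2 = 1, where b is an involution
    of one four-group and a1, a2, a3 are the involutions of the other, and that
    a closed walk of length 12 that begins with b, a, b', a' has b = b' or
    a = a'.  As f preserves closed walks, comparing the two relations that begin
    with b, a, b shows that the two labels b are changed in the same way
    ([d_alternate]); this propagates along the graph, so that f changes labels
    by one pair of bijections A -> A and B -> B ([d_const]).  Since f fixes the
    labels of the 3-arc, each bijection is the identity or the exchange of two
    involutions, that is, a transvection of F_2^2.  So phi = 1 as soon as, for
    each of the 15 nontrivial pairs of transvections, some relation of P is
    carried to a word that is not a relation ([chiral_rigid]).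

    A suitable P comes from covers of the complete bipartite graph K_{4,4},
    which is the case P = A x B.  The kernel N of the map from the free product
    A * B to A x B is free on the commutators [b_i, a_j], and its abelianization
    is V (x) V, with V the root lattice of type A_3.  A voltage in Z/m records
    the homology class of a closed walk modulo m; for m > 12 this alone forces
    the stated property of closed walks of length 12.  A second voltage, in the
    64-element group generated by the Pauli matrices on two qubits and by the
    scalar i, gives the chirality.  On this factor the squares of the elements
    of N are the values of a quadratic form on N / N^2: a two-by-two minor, whose
    polarization is compatible with the relations above, plus a linear form.  Let
    W = F_4 be the quotient of V / 2 V by its one-dimensional submodule.  The
    linear form factors through W (x) W and is x (x) y -> Tr(c x y) there.
    Transvections act on W as Frobenius maps composed with scalars, and c is
    chosen such that no pair of them respects both parts of the quadratic form.
    Acting simultaneously on 18 copies of the cover, one for each element of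
    C_3 wr C_2, makes the required automorphisms of P available.  The Pauli part
    of a chiral relation survives raising to the power m, which removes its
    homology, when m is odd ([eval_chiral]).

    Finally x^(128 m) = 1 for all x in P.  When m is a power of 3 the order
    18 |P| of the automorphism group is therefore divisible by no prime other
    than 2 and 3, and that group is solvable by the theorem of Burnside.  The
    graphs are arbitrarily large, since P has an element of order at least m. *)

(** * Labels *)

(** The four-group is written additively, as F_2^2. *)
Definition klein := (bool * bool)%type.
Definition v0 : klein := (false, false).
Definition v1 : klein := (true, false).
Definition v2 : klein := (false, true).
Definition v3 : klein := (true, true).
Definition addv (x y : klein) : klein := (x.1 (+) y.1, x.2 (+) y.2).

Lemma addvA : associative addv.
Proof. by move=> [a b] [c d] [e f]; rewrite /addv /= !addbA. Qed.
Lemma addvC : commutative addv.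
Proof. by move=> [a b] [c d]; rewrite /addv /= addbC [b (+) _]addbC. Qed.
Lemma add0v : left_id v0 addv.
Proof. by move=> [a b]. Qed.
Lemma addv0 : right_id v0 addv.
Proof. by move=> x; rewrite addvC add0v. Qed.
Lemma addvv x : addv x x = v0.
Proof. by case: x => a b; rewrite /addv /= !addbb. Qed.
Lemma addvK x y : addv x (addv x y) = y.
Proof. by rewrite addvA addvv add0v. Qed.
Lemma addvI x y z : addv x y = addv x z -> y = z.
Proof. by move=> E; rewrite -(addvK x y) E addvK. Qed.
Lemma addv_eq0 x y : addv x y = v0 -> x = y.
Proof. by move=> E; apply: (@addvI y); rewrite addvv addvC. Qed.

Lemma neq_negb (s t : bool) : t != s -> t = ~~ s.
Proof. by case: t; case: s. Qed.

(** The boolean tells in which of the two four-groups a letter lies. *)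
Definition letter := (bool * klein)%type.
Definition relabel (d : bool -> klein -> klein) (l : letter) : letter :=
  (l.1, d l.1 l.2).
(** The factor deciding the case is the alternating form on F_2^2, so these are
    the identity (for [c = v0]) and the three exchanges of two nonzero
    labels. *)
Definition transvection (c x : klein) : klein :=
  if (c.1 && x.2) (+) (c.2 && x.1) then addv x c else x.
Definition alt s (ps : seq (klein * klein)) : seq letter :=
  flatten [seq [:: (s, p.1); (~~ s, p.2)] | p <- ps].
(** Over K_{4,4} this word, of length 12, is the commutator of two 4-cycles
    sharing a path of length 2: it winds around the theta graph K_{2,3}, using
    each edge once in either direction. *)
Definition theta_word (s : bool) (b x y : klein) : seq letter :=
  let ps := [:: (b, x); (b, y); (b, addv x y)] in alt s (ps ++ ps).

(** GL_2(2) is the full symmetric group on the three nonzero vectors. *)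
Lemma inj_addv (d : klein -> klein) : injective d -> d v0 = v0 ->
  forall x y, d (addv x y) = addv (d x) (d y).
Proof.
move=> d_inj d0.
have n01 : d v1 <> v0 by rewrite -d0 => /d_inj.
have n02 : d v2 <> v0 by rewrite -d0 => /d_inj.
have n03 : d v3 <> v0 by rewrite -d0 => /d_inj.
have n12 : d v1 <> d v2 by move/d_inj.
have n13 : d v1 <> d v3 by move/d_inj.
have n23 : d v2 <> d v3 by move/d_inj.
move: n01 n02 n03 n12 n13 n23 d0; rewrite /v0 /v1 /v2 /v3 => n01 n02 n03 n12 n13 n23 d0.
case E1: (d (true, false)) n01 n12 n13 => [[] []] // n01 n12 n13;
case E2: (d (false, true)) n02 n12 n23 => [[] []] // n02 n12 n23;
case E3: (d (true, true)) n03 n13 n23 => [[] []] // n03 n13 n23;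
by move=> [[] []] [[] []]; rewrite /addv /= ?d0 ?E1 ?E2 ?E3.
Qed.

Lemma inj_transvection (d : klein -> klein) u : injective d -> d v0 = v0 ->
  u != v0 -> d u = u -> exists c, d =1 transvection c.
Proof.
move=> d_inj d0 u0 du; have dD := inj_addv d_inj d0.
have d3 : d v3 = addv (d v1) (d v2) by rewrite -dD.
suff [c [c1 c2]] : exists c, d v1 = transvection c v1 /\ d v2 = transvection c v2.
  exists c => -[[] []]; rewrite -/v0 -/v1 -/v2 -/v3 ?d0 ?d3 ?c1 ?c2 //.
  - by case: (c) => [[] []].
  by case: (c) => [[] []].
have n1 : d v1 <> v0 by rewrite -d0 => /d_inj.
have n2 : d v2 <> v0 by rewrite -d0 => /d_inj.
have n12 : d v1 <> d v2 by move/d_inj.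
case: u u0 du => [[] []] // _; rewrite -/v1 -/v2 -/v3 ?d3 => du;
  case E1: (d v1) n1 n12 du => [[] []] // n1 n12 du;
  case E2: (d v2) n2 n12 du => [[] []] // n2 n12 du;
  by [exists v0 | exists v1 | exists v2 | exists v3].
Qed.

(** * The coset graph of two four-groups *)

Section CosetGraph.
Variables (gT : finGroupType) (g : bool -> klein -> gT).
Hypothesis gD : forall s x y, g s (addv x y) = g s x * g s y.
Hypothesis g_inj : forall s, injective (g s).
Hypothesis g_disj : forall s x y, g s x = g (~~ s) y -> x = v0.

Lemma g0 s : g s v0 = 1.
Proof. by apply: (mulgI (g s v0)); rewrite -gD add0v mulg1. Qed.
Lemma gV s x : (g s x)^-1 = g s x.
Proof. by apply: (mulgI (g s x)); rewrite mulgV -gD addvv g0. Qed.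

Definition side_set s : {set gT} := [set g s x | x : klein].
Lemma side_group_set s : group_set (side_set s).
Proof.
apply/group_setP; split=> [|_ _ /imsetP[x _ ->] /imsetP[y _ ->]].
  by apply/imsetP; exists v0; rewrite ?g0.
by rewrite -gD imset_f.
Qed.
Canonical side s := Group (side_group_set s).

Definition edges : {group gT} := <<side_set false :|: side_set true>>%G.

Lemma mem_side s x : g s x \in side s.
Proof. exact: imset_f. Qed.
Lemma sideP s y : reflect (exists x, y = g s x) (y \in side s).
Proof. by apply: (iffP imsetP) => [[x _ ->]|[x ->]]; exists x. Qed.
Lemma side_edges s : side s \subset edges.
Proof.
by apply: subset_trans (subset_gen _); case: s; rewrite ?subsetUl ?subsetUr.
Qed.
Lemma mem_edges s x : g s x \in edges.
Proof. by rewrite (subsetP (side_edges s)) ?mem_side. Qed.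
Lemma edgeM y s x : y \in edges -> y * g s x \in edges.
Proof. by move=> ?; rewrite groupM ?mem_edges. Qed.

Lemma side_trivI s y : y \in side s -> y \in side (~~ s) -> y = 1.
Proof. by move=> /sideP[x ->] /sideP[z] /g_disj ->; rewrite g0. Qed.
Lemma card_side s : #|side s| = 4.
Proof. by rewrite card_imset // card_prod card_bool. Qed.

(** Connectedness of the graph, in terms of edges. *)
Lemma edges_ind (Q : gT -> Prop) y0 :
  y0 \in edges -> Q y0 ->
  (forall y s x, y \in edges -> Q y -> Q (y * g s x)) ->
  forall y, y \in edges -> Q y.
Proof.
move=> Ey0 Qy0 QM y Ey.
have /gen_prodgP[n [c Hc Dy]] : y0^-1 * y \in edges by rewrite groupM ?groupV.
have {Dy} -> : y = y0 * \prod_i c i by rewrite -Dy mulKVg.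
elim: n c Hc => [|n IHn] c Hc; first by rewrite big_ord0 mulg1.
rewrite big_ord_recr mulgA /=.
have {}IHn := IHn (fun i => c (widen_ord (leqnSn n) i)) (fun i => Hc _).
have Ec i : c i \in edges by rewrite mem_gen.
have [s [x ->]] : exists s x, c ord_max = g s x.
  by case/setUP: (Hc ord_max) => /sideP[x ->]; [exists false|exists true]; exists x.
apply: QM => //; rewrite groupM // group_prod // => i _; exact: Ec.
Qed.

Definition coset_set : {set {set gT}} :=
  [set S | [exists s, S \in lcosets (side s) edges]].
Lemma coset_setP S :
  reflect (exists s y, y \in edges /\ S = y *: side s) (S \in coset_set).
Proof.
rewrite inE; apply: (iffP existsP) => [[s /lcosetsP[y Ey ->]]|[s [y [Ey ->]]]].
  by exists s, y.
by exists s; apply/lcosetsP; exists y.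
Qed.

Definition coset_vertex := {S : {set gT} | S \in coset_set}.
(** Distinct cosets of the same subgroup are disjoint, so two distinct vertices
    that meet are on different sides. *)
Definition coset_adj (u v : coset_vertex) :=
  (val u != val v) && (val u :&: val v != set0).
Lemma coset_adj_sym : symmetric coset_adj.
Proof. by move=> u v; rewrite /coset_adj eq_sym setIC. Qed.
Lemma coset_adj_irr : irreflexive coset_adj.
Proof. by move=> u; rewrite /coset_adj eqxx. Qed.
Definition coset_graph := SGraph coset_adj_sym coset_adj_irr.

Lemma coset_set1 : (1 *: side true) \in coset_set.
Proof. by apply/coset_setP; exists true, 1; rewrite group1. Qed.
(** The coset of 1 is a junk value, used when [y] is not in [edges]. *)
Definition vtx s y : coset_graph :=
  insubd (exist (fun S => S \in coset_set) _ coset_set1) (y *: side s : {set gT}).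

Lemma val_vtx s y : y \in edges -> val (vtx s y) = y *: side s.
Proof.
move=> Ey; rewrite val_insubd; case: ifP => // /negP[].
by apply/coset_setP; exists s, y.
Qed.
Lemma vtxP (v : coset_graph) : exists s y, y \in edges /\ v = vtx s y.
Proof.
have /coset_setP[s [y [Ey Dv]]] := valP v; exists s, y; split=> //.
by apply: val_inj; rewrite val_vtx.
Qed.
Lemma vtx_eq s y z : y \in edges -> z \in edges ->
  (vtx s y == vtx s z) = (y^-1 * z \in side s).
Proof.
move=> Ey Ez; rewrite -val_eqE /= !val_vtx // -mem_lcoset.
by apply/eqP/idP => [->|/lcoset_eqP ->]; rewrite ?lcoset_refl.
Qed.
Lemma vtx_neq s y z : y \in edges -> z \in edges ->
  (vtx s y == vtx (~~ s) z) = false.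
Proof.
move=> Ey Ez; rewrite -val_eqE /= !val_vtx //; apply/eqP => Dy.
have zy : z^-1 * y \in side (~~ s) by rewrite -mem_lcoset -Dy lcoset_refl.
have E : side s = side (~~ s) :> {set _}.
  by apply: (@lcoset_inj _ y); rewrite Dy; apply/lcoset_eqP; rewrite lcoset_sym mem_lcoset.
have := @side_trivI s (g s (true,true)) (mem_side _ _).
by rewrite -E mem_side => /(_ isT); rewrite -(g0 s) => /g_inj.
Qed.
Lemma vtxM s y x : y \in edges -> vtx s (y * g s x) = vtx s y.
Proof.
by move=> Ey; apply/esym/eqP; rewrite vtx_eq ?edgeM // mulKg mem_side.
Qed.

Lemma adj_vtx s y : y \in edges -> adj (vtx s y) (vtx (~~ s) y).
Proof.
move=> Ey; rewrite /adj /= /coset_adj val_eqE vtx_neq //= !val_vtx //.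
by apply/set0Pn; exists y; rewrite inE !lcoset_refl.
Qed.

Lemma adjP s y (v : coset_graph) : y \in edges ->
  reflect (exists x, v = vtx (~~ s) (y * g s x)) (adj (vtx s y) v).
Proof.
move=> Ey; apply: (iffP idP) => [|[x ->]]; last first.
  by rewrite -(vtxM s x Ey) adj_vtx ?edgeM.
have [t [z [Ez ->]]] := vtxP v.
case/andP=> Dvz /set0Pn[w]; rewrite !val_vtx // => /setIP[].
rewrite mem_lcoset => /sideP[x Dw] zw.
have Dw' : w = y * g s x by rewrite -Dw mulKVg.
exists x; rewrite -Dw'; have Ew : w \in edges by rewrite Dw' edgeM.
have [Ets|nts] := eqVneq t s; last first.
  by rewrite (neq_negb nts) in Ez zw *; apply/eqP; rewrite vtx_eq // -mem_lcoset.
case/negP: Dvz; subst t; apply/eqP.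
  rewrite !val_vtx //; apply/lcoset_eqP.
  by apply: lcoset_trans zw; rewrite lcoset_sym Dw' mem_lcoset mulKg mem_side.
Qed.

Lemma coset_graph_valency : tetravalent coset_graph.
Proof.
move=> v; have [s [y [Ey ->]]] := vtxP v; rewrite /valency.
have -> : [set w | adj (vtx s y) w] = [set vtx (~~ s) (y * g s x) | x : klein].
  by apply/setP => w; rewrite inE; apply/(adjP s _ Ey)/imsetP => [[x ->]|[x _ ->]]; exists x.
rewrite card_imset ?card_prod ?card_bool // => a b /eqP.
rewrite vtx_eq ?edgeM // invMg -mulgA mulKg gV -gD.
move/(side_trivI (mem_side _ _)); rewrite -(g0 s) => /g_inj; exact: addv_eq0.
Qed.

(** The middle edge of this 3-arc is [y]; its two outer edges are obtained from
    [y] by the labels [u] and [w]. *)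
Definition arc s y u w : 4.-tuple coset_graph :=
  [tuple vtx (~~ s) (y * g s u); vtx s y; vtx (~~ s) y;
         vtx s (y * g (~~ s) w)].

Lemma is_three_arcE (a b c d : coset_graph) :
  is_three_arc [tuple a; b; c; d] =
  [&& adj a b, adj b c, adj c d, a != c & b != d].
Proof. by rewrite /is_three_arc !(tnth_nth a) !inordK. Qed.

Lemma vtx_step s y x : y \in edges ->
  (vtx (~~ s) (y * g s x) == vtx (~~ s) y) = (x == v0).
Proof.
move=> Ey; rewrite eq_sym vtx_eq ?edgeM // mulKg.
apply/idP/eqP => [/(side_trivI (mem_side _ _))|->]; last by rewrite g0 group1.
by rewrite -(g0 s) => /g_inj.
Qed.

Lemma three_arcsP (t : 4.-tuple coset_graph) :
  reflect (exists s y u w, [/\ y \in edges, u != v0, w != v0 & t = arc s y u w])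
          (t \in three_arcs coset_graph).
Proof.
rewrite inE; apply: (iffP idP) => [|[s [y [u [w [Ey u0 w0 ->]]]]]]; last first.
  rewrite is_three_arcE; apply/and5P; split.
  - by rewrite adj_sym; apply/(adjP s _ Ey); exists u.
  - exact: adj_vtx.
  - by apply/(adjP _ _ Ey); exists w; rewrite negbK.
  - by rewrite vtx_step.
  by have := vtx_step (~~ s) w Ey; rewrite negbK eq_sym => ->.
case/tupleP: t => a t; case/tupleP: t => b t; case/tupleP: t => c t.
case/tupleP: t => d t; rewrite (tuple0 t) {t}.
have -> : [tuple of a :: [tuple of b :: [tuple of c :: [tuple of d :: [tuple]]]]]
  = [tuple a; b; c; d] by apply: val_inj.
rewrite is_three_arcE => /and5P[ab bc cd ac bd].
have [s [z [Ez Db]]] := vtxP b; subst b.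
have /(adjP _ _ Ez)[x Dc] := bc; subst c.
pose y := z * g s x; have Ey : y \in edges by rewrite edgeM.
have Db : vtx s z = vtx s y by rewrite vtxM.
rewrite -/y Db in ab bc cd ac bd *.
move: ab; rewrite adj_sym => /(adjP _ _ Ey)[u Da].
have /(adjP _ _ Ey)[w Dd] := cd; rewrite negbK in Dd.
exists s, y, u, w; split=> //.
- by rewrite Da vtx_step in ac.
- by have := vtx_step (~~ s) w Ey; rewrite negbK -Dd eq_sym => <-.
by rewrite Da Dd.
Qed.

(** Used with [h] a translation followed by an automorphism of the group; [e]
    tells whether the two sides are exchanged. *)
Lemma lift_aut (h : gT -> gT) e : injective h ->
    (forall y, y \in edges -> h y \in edges) ->
    (forall s y x, y \in edges -> (h y)^-1 * h (y * g s x) \in side (s (+) e)) ->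
  exists2 phi : {perm coset_graph}, phi \in graph_aut coset_graph
    & forall s y, y \in edges -> phi (vtx s y) = vtx (s (+) e) (h y).
Proof.
move=> h_inj hE hg.
have him s y : y \in edges -> h @: (y *: side s) = h y *: side (s (+) e).
  move=> Ey; apply/eqP; rewrite eqEcard card_imset // !card_lcoset !card_side leqnn andbT.
  apply/subsetP=> _ /imsetP[_ /lcosetP[_ /sideP[x ->] ->] ->].
  by rewrite mem_lcoset hg.
pose F (v : coset_graph) : coset_graph := insubd v (h @: val v).
have FE v : val (F v) = h @: val v.
  rewrite val_insubd; case: ifP => // /negP[].
  have [s [y [Ey ->]]] := vtxP v; rewrite val_vtx // him //.
  by apply/coset_setP; exists (s (+) e), (h y); rewrite hE.
have F_inj : injective F.
  by move=> u v /(congr1 val); rewrite !FE => /(imset_inj h_inj)/val_inj.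
exists (perm F_inj).
  rewrite inE; apply/'forall_'forall_eqP => u v; rewrite !permE /adj /= /coset_adj.
  rewrite !FE (inj_eq (imset_inj h_inj)) -imsetI; last by move=> ? ? _ _; apply: h_inj.
  by rewrite imset_eq0.
move=> s y Ey; rewrite permE; apply: val_inj.
by rewrite FE !val_vtx ?hE ?him.
Qed.

(** The maps induced on edges by the graph automorphisms that preserve the
    sides. *)
Definition label_map (f : gT -> gT) :=
  (forall y, y \in edges -> f y \in edges) /\
  (forall s y z, y \in edges -> z \in edges ->
     ((f y)^-1 * f z \in side s) = (y^-1 * z \in side s)).

Lemma aut_adj (phi : {perm coset_graph}) u v : phi \in graph_aut coset_graph ->
  adj (phi u) (phi v) = adj u v.
Proof. by rewrite inE => /'forall_'forall_eqP. Qed.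

(** Edges go to edges because an edge is a pair of adjacent vertices.  One fixed
    vertex forces all sides to be preserved, since the side alternates along
    any walk. *)
Lemma aut_label_map (phi : {perm coset_graph}) s0 y0 :
    phi \in graph_aut coset_graph -> y0 \in edges ->
    phi (vtx s0 y0) = vtx s0 y0 ->
  exists2 f, label_map f
    & forall s y, y \in edges -> phi (vtx s y) = vtx s (f y).
Proof.
move=> Aphi Ey0 phi0.
have edge_im s y z : y \in edges -> z \in edges -> phi (vtx s y) = vtx s z ->
    exists2 z', z' \in edges & forall t, phi (vtx t y) = vtx t z'.
  move=> Ey Ez Dz.
  have: adj (vtx s z) (phi (vtx (~~ s) y)) by rewrite -Dz aut_adj ?adj_vtx.
  case/(adjP _ _ Ez) => x Dx; exists (z * g s x); first exact: edgeM.
  move=> t; have [->|] := eqVneq t s; first by rewrite vtxM.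
  by move/neq_negb->.
have ex_im y : y \in edges ->
    exists2 z, z \in edges & forall t, phi (vtx t y) = vtx t z.
  move: y; apply: (edges_ind Ey0); first exact: (edge_im s0 _ y0).
  move=> y s x Ey [z Ez Dz].
  by apply: (edge_im s _ z); rewrite ?edgeM ?vtxM.
pose ok y z := (z \in edges) && [forall t, phi (vtx t y) == vtx t z].
have [f fP] : exists f, forall y, y \in edges -> ok y (f y).
  exists (fun y => odflt 1 [pick z | ok y z]) => y /ex_im[z Ez Dz].
  by case: pickP => //= /(_ z); rewrite /ok Ez /= => /forallP[] t; rewrite Dz.
have Ef y : y \in edges -> f y \in edges by case/fP/andP.
have Df s y : y \in edges -> phi (vtx s y) = vtx s (f y).
  by case/fP/andP => _ /forallP/(_ s)/eqP.
exists f => //; split=> // s y z Ey Ez.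
rewrite -(vtx_eq s (Ef _ Ey) (Ef _ Ez)) -(vtx_eq s Ey Ez) -(Df s y) // -(Df s z) //.
exact: (inj_eq (@perm_inj _ phi)).
Qed.

(** The three edges [y], [y * g s u] and [y * g (~~ s) w] form a 3-arc. *)
Definition rigid := forall f s y u w, label_map f -> y \in edges ->
  u != v0 -> w != v0 -> f y = y -> f (y * g s u) = y * g s u ->
  f (y * g (~~ s) w) = y * g (~~ s) w -> forall z, z \in edges -> f z = z.

Lemma vtx_inj y z : y \in edges -> z \in edges ->
  (forall s, vtx s y = vtx s z) -> y = z.
Proof.
move=> Ey Ez E; apply/eqP; rewrite -(inj_eq (mulgI y^-1)) mulVg; apply/eqP/esym.
by apply: (@side_trivI true); rewrite -vtx_eq // E.
Qed.

Lemma rigid_stab phi t : rigid -> phi \in graph_aut coset_graph ->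
  t \in three_arcs coset_graph -> n_act 'P t phi = t -> phi = 1.
Proof.
move=> R Aphi /three_arcsP[s [y [u [w [Ey u0 w0 ->]]]]] Dt.
have fixv i : phi (tnth (arc s y u w) i) = tnth (arc s y u w) i.
  by rewrite -[in RHS]Dt tnth_map.
have F0 := fixv (inord 0); have F1 := fixv (inord 1).
have F2 := fixv (inord 2); have F3 := fixv (inord 3).
rewrite !(tnth_nth (vtx s y)) !inordK //= in F0 F1 F2 F3.
have [f Lf Df] := aut_label_map Aphi Ey F1.
have [Ef _] := Lf.
have fixe t' z : z \in edges -> phi (vtx t' z) = vtx t' z ->
    phi (vtx (~~ t') z) = vtx (~~ t') z -> f z = z.
  move=> Ez A B; apply: vtx_inj => //; first exact: Ef.
  move=> r; rewrite -Df //; have [->//|] := eqVneq r t'.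
  by move/neq_negb->.
have fE : forall z, z \in edges -> f z = z.
  apply: (R f s y u w) => //.
  - exact: (fixe s).
  - by apply: (fixe s); rewrite ?edgeM ?vtxM.
  by apply: (fixe s); rewrite ?edgeM ?vtxM.
apply/permP => v; rewrite perm1; have [r [z [Ez ->]]] := vtxP v.
by rewrite Df // fE.
Qed.

(** Stated for the base 3-arc with labels [v1], [v1] on both sides of the
    edge 1; conjugation by [c] and a translation then carry it to any other. *)
Definition arc_symmetric := forall s u w, u != v0 -> w != v0 ->
  exists c, [/\ forall t x, g t x ^ c \in side (t (+) ~~ s),
                g true v1 ^ c = g s u & g false v1 ^ c = g (~~ s) w].

Lemma arc_trans s y u w : arc_symmetric -> y \in edges -> u != v0 -> w != v0 ->
  exists2 phi, phi \in graph_aut coset_graph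
    & n_act 'P (arc true 1 v1 v1) phi = arc s y u w.
Proof.
move=> symg Ey u0 w0; have [c [cH cu cw]] := symg s u w u0 w0.
have cE z : z \in edges -> z ^ c \in edges.
  move: z; apply: (edges_ind (group1 _)) => [|z t x Ez cz]; first by rewrite conj1g.
  by rewrite conjMg groupM // (subsetP (side_edges _) _ (cH _ _)).
have [| | |phi Aphi Dphi] := @lift_aut (fun z => y * z ^ c) (~~ s).
- by move=> a b /mulgI/conjg_inj.
- by move=> z Ez; rewrite groupM ?cE.
- by move=> t z x Ez; rewrite /= conjMg (mulgA y (z ^ c)) mulKg cH.
exists phi => //; apply: val_inj => /=.
rewrite /aperm !mul1g !Dphi ?mem_edges ?group1 //= conj1g mulg1 cu cw.
by rewrite /= negbK.
Qed.

Theorem coset_graph_regular : rigid -> arc_symmetric -> three_arc_regular coset_graph.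
Proof.
move=> rig symg; split; first by exists 4; apply: coset_graph_valency.
  have T1 : arc true 1 v1 v1 \in three_arcs coset_graph.
    by apply/three_arcsP; exists true, 1, v1, v1; rewrite group1.
  apply/imsetP; exists (arc true 1 v1 v1) => //; apply/setP => t.
  apply/three_arcsP/orbitP => [[s [y [u [w [Ey u0 w0 ->]]]]]|[phi Aphi <-]].
    by have [phi Aphi Dphi] := arc_trans s symg Ey u0 w0; exists phi.
  apply/three_arcsP; rewrite inE; move: T1; rewrite inE.
  set t1 := arc _ _ _ _.
  have actE i : tnth (('P * 4)%act t1 phi) i = phi (tnth t1 i) by rewrite tnth_map.
  by rewrite /is_three_arc !actE !(aut_adj _ _ Aphi) !(inj_eq (@perm_inj _ phi)).
move=> t t3; apply/trivgP/subsetP => phi /setIP[Aphi].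
by move/astab1P => /= Dphi; rewrite inE; apply/eqP/(rigid_stab rig Aphi t3 Dphi).
Qed.

(** A 3-arc is given by its middle edge, its direction and two nonzero
    labels. *)
Lemma card_three_arcs : #|three_arcs coset_graph| = (#|edges| * 18)%N.
Proof.
pose D : {set gT * (bool * (klein * klein))} :=
  setX edges (setX setT (setX [set~ v0] [set~ v0])).
pose F (p : gT * (bool * (klein * klein))) := arc p.2.1 p.1 p.2.2.1 p.2.2.2.
have -> : three_arcs coset_graph = F @: D.
  apply/setP => t; apply/three_arcsP/imsetP.
    move=> [s [y [u [w [Ey u0 w0 ->]]]]]; exists (y, (s, (u, w))) => //.
    by rewrite !inE Ey u0 w0.
  case=> [[y [s [u w]]]]; rewrite !inE /= => /andP[Ey /andP[u0 w0]] ->.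
  by exists s, y, u, w.
rewrite card_in_imset; last first.
  move=> [y [s [u w]]] [y' [s' [u' w']]]; rewrite !inE /=.
  move=> /andP[Ey /andP[u0 w0]] /andP[Ey' /andP[u0' w0']] /(congr1 val)[].
  move=> E0 E1 E2 E3.
  have ss : s' = s.
    apply/eqP; rewrite -negb_add; apply/negP; rewrite addbC => /addbP Es.
    by move/eqP: E1; rewrite -Es vtx_neq.
  subst s'; have yy : y' = y.
    apply: vtx_inj => // r; have [->//|] := eqVneq r s.
    by move/neq_negb->.
  subst y'; congr (_, (_, (_, _))).
    by move/eqP: E0; rewrite vtx_eq ?edgeM // invMg -mulgA mulKg gV -gD
      => /(side_trivI (mem_side _ _)); rewrite -(g0 s) => /g_inj/addv_eq0.
  move/eqP: E3; rewrite vtx_eq ?edgeM // invMg -mulgA mulKg gV -gD.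
  have := @side_trivI (~~ s) _ (mem_side _ (addv w w')); rewrite negbK => H /H.
  by rewrite -(g0 (~~ s)) => /g_inj/addv_eq0.
have c3 : #|[set~ v0]| = 3.
  by rewrite cardsC1 card_prod card_bool.
by rewrite !cardsX c3 cardsT card_bool.
Qed.

Lemma card_graph_aut : three_arc_regular coset_graph ->
  #|graph_aut coset_graph| = (#|edges| * 18)%N.
Proof.
move=> [_ /imsetP[t t3 Dt] st].
by rewrite -(card_orbit_stab ('P * 4) _ t) st // cards1 muln1 -Dt card_three_arcs.
Qed.

(** An edge is determined by its two ends. *)
Lemma card_edges_le : (#|edges| <= #|coset_graph| ^ 2)%N.
Proof.
rewrite expnS expn1 -card_prod.
rewrite -(card_in_imset (f := fun y => (vtx true y, vtx false y))); last first.
  by move=> y z Ey Ez [Et Ef]; apply: vtx_inj => // -[].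
exact: max_card.
Qed.

(** * Rigidity from closed walks of length 12 *)

Definition eval (w : seq letter) : gT := \prod_(l <- w) g l.1 l.2.
Lemma eval_nil : eval [::] = 1. Proof. exact: big_nil. Qed.
Lemma eval_cons l w : eval (l :: w) = g l.1 l.2 * eval w.
Proof. exact: big_cons. Qed.

Section Rigidity.
Hypothesis theta1 : forall s (b x y : klein), b != v0 -> x != v0 -> y != v0 -> x != y ->
  eval (theta_word s b x y) = 1.
Hypothesis short_closed : forall s (p q : klein * klein) (r : seq (klein * klein)),
  size r = 4 -> all (fun p : klein * klein => (p.1 != v0) && (p.2 != v0)) (p :: q :: r) ->
  eval (alt s (p :: q :: r)) = 1 -> p.1 = q.1 \/ p.2 = q.2.
Hypothesis chiral : forall c : bool -> klein, (exists s, c s != v0) ->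
  exists2 w, eval w = 1 & eval (map (relabel (fun s => transvection (c s))) w) <> 1.

Lemma eval_edges w : eval w \in edges.
Proof. by apply: group_prod => l _; apply: mem_edges. Qed.

(** Here [d y s x] is the label that replaces [x] at the edge [y]. *)
Section LabelMap.
Variables (f : gT -> gT) (d : gT -> bool -> klein -> klein).
Hypothesis f_label : label_map f.
Hypothesis fd : forall y s x, y \in edges -> f (y * g s x) = f y * g s (d y s x).

Lemma label_map_inj y z : y \in edges -> z \in edges -> f y = f z -> y = z.
Proof.
case: f_label => Ef fs Ey Ez E; apply/eqP; rewrite -(inj_eq (mulgI y^-1)) mulVg eq_sym.
apply/eqP/(@side_trivI true); rewrite /= -fs // E mulVg; exact: group1.
Qed.

Lemma d_inj y s : y \in edges -> injective (d y s).
Proof.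
move=> Ey x x' Ed; apply: (@g_inj s); apply: (mulgI y).
by apply: label_map_inj; rewrite ?edgeM // !fd // Ed.
Qed.
Lemma d0 y s : y \in edges -> d y s v0 = v0.
Proof.
move=> Ey; apply: (@g_inj s); apply: (mulgI (f y)).
by rewrite -fd // g0 // !mulg1.
Qed.
Lemma d_neq0 y s x : y \in edges -> x != v0 -> d y s x != v0.
Proof. by move=> Ey; apply: contra_neq => dx0; apply: (d_inj Ey (s := s)); rewrite dx0 d0. Qed.
Lemma dD y s x x' : y \in edges ->
  d y s (addv x x') = addv (d y s x) (d y s x').
Proof. by move=> Ey; apply: inj_addv; [apply: d_inj|apply: d0]. Qed.

(** Moving along the four edges at one vertex does not change the relabelling of
    that vertex, because the relabelling is additive. *)
Lemma d_same_side y s x : y \in edges -> d (y * g s x) s =1 d y s.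
Proof.
move=> Ey z; apply: (@addvI (d y s x)); rewrite -dD //.
apply: (@g_inj s); apply: (mulgI (f y)); rewrite -fd // !gD !mulgA.
by rewrite fd ?edgeM // fd.
Qed.

Fixpoint path_labels y (w : seq letter) : seq letter :=
  if w is l :: w' then (l.1, d y l.1 l.2) :: path_labels (y * g l.1 l.2) w' else [::].
Lemma path_labelsP y w : y \in edges ->
  f (y * eval w) = f y * eval (path_labels y w).
Proof.
elim: w y => [|l w IHw] y Ey /=; first by rewrite !eval_nil !mulg1.
by rewrite !eval_cons mulgA IHw ?edgeM // fd // mulgA.
Qed.

(** Two relations begin with b, a, b, one for each of the two labels x other
    than a that may come next.  Their images under [f] are closed walks of
    length 12; if the images of the two letters b differed, the image of a
    would coincide with those of both labels x, which are distinct. *)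
Lemma d_alternate y s b a : y \in edges -> b != v0 -> a != v0 ->
  d (y * g s b * g (~~ s) a) s b = d y s b.
Proof.
move=> Ey b0 a0.
have loop x : x != v0 -> a != x ->
    d (y * g s b * g (~~ s) a) s b = d y s b \/
    d (y * g s b) (~~ s) a = d (y * g s b * g (~~ s) a * g s b) (~~ s) x.
  move=> x0 ax; have := path_labelsP (theta_word s b a x) Ey.
  rewrite theta1 // mulg1 -[LHS]mulg1 => /mulgI/esym /=.
  set y1 := y * g s b; set y2 := y1 * _; set y3 := y2 * _; set y4 := y3 * _.
  set y5 := y4 * _; set y6 := y5 * _; set y7 := y6 * _; set y8 := y7 * _.
  set y9 := y8 * _; set y10 := y9 * _; set y11 := y10 * _ => E.
  pose p i j u := (d i s b, d j (~~ s) u).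
  have := @short_closed s (p y y1 a) (p y2 y3 x)
    [:: p y4 y5 (addv a x); p y6 y7 a; p y8 y9 x; p y10 y11 (addv a x)] erefl _ E.
  have x20 : addv a x != v0 by apply: contra ax => /eqP/addv_eq0 ->.
  rewrite /= !d_neq0 ?edgeM // => /(_ isT) [->|->]; [by left|by right].
(* A label outside {0, a}; the third nonzero label is then a + x. *)
have /and3P[x0 ax ay] : [&& (a.2, a.1 (+) a.2) != v0, a != (a.2, a.1 (+) a.2)
    & addv a (a.2, a.1 (+) a.2) != v0].
  by case: (a) a0 => [[] []].
move: (a.2, a.1 (+) a.2) x0 ax ay => x x0 ax ay.
have ya : a != addv a x by apply: contra x0 => /eqP E; apply/eqP/(@addvI a); rewrite -E addv0.
have [//|e1] := loop x x0 ax; have [//|e2] := loop _ ay ya.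
have Ey3 : y * g s b * g (~~ s) a * g s b \in edges by rewrite !edgeM.
have Dx := d_inj Ey3 (etrans (esym e1) e2).
by case/eqP: a0; apply: (@addvI x); rewrite addvC -Dx addv0.
Qed.

(** For [t] different from [s] one inserts a back-and-forth step b, b before the
    step x: [d_alternate] then compares the label b at the first intermediate
    edge and at the end. *)
Lemma d_step y s t x : y \in edges -> d (y * g t x) s =1 d y s.
Proof.
move=> Ey b; have [->|] := eqVneq t s; first exact: d_same_side.
move/neq_negb->.
have [->|b0] := eqVneq b v0; first by rewrite !d0 ?edgeM.
have [->|x0] := eqVneq x v0; first by rewrite g0 mulg1.
have Ey' : y * g s b \in edges by rewrite edgeM.
have := @d_alternate _ s b x Ey' b0 x0.
rewrite -mulgA -mulgA (mulgA (g s b)) -gD addvv g0 mul1g => ->.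
exact: d_same_side.
Qed.

Lemma d_const y z s : y \in edges -> z \in edges -> d z s =1 d y s.
Proof.
move=> Ey; move: z; apply: (edges_ind Ey) => // z t x Ez IH u.
by rewrite d_step // IH.
Qed.

Lemma label_map_eval y w : y \in edges ->
  f (y * eval w) = f y * eval (map (relabel (d y)) w).
Proof.
move=> Ey; have: forall z, z \in edges -> f (z * eval w) = f z * eval (map (relabel (d y)) w).
  elim: w => [|l w IHw] z Ez /=; first by rewrite !eval_nil !mulg1.
  by rewrite !eval_cons mulgA IHw ?edgeM // fd // mulgA (d_const _ Ey Ez).
exact.
Qed.
End LabelMap.

(** The relabelling is constant, and it fixes a nonzero label on either side, so
    it is a pair of transvections; it carries relations to relations. *)
Theorem chiral_rigid : rigid.
Proof.
move=> f s y u w Lf Ey u0 w0 fy fu fw.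
have [Ef Hf] := Lf.
have [d fd] : exists d : gT -> bool -> klein -> klein,
    forall y s x, y \in edges -> f (y * g s x) = f y * g s (d y s x).
  exists (fun y s x => odflt v0 [pick x' | f (y * g s x) == f y * g s x']).
  move=> z t x Ez; case: pickP => [x' /eqP //|/= no].
  have /sideP[x' Dx'] : (f z)^-1 * f (z * g t x) \in side t.
    by rewrite Hf ?edgeM // mulKg mem_side.
  by have /eqP[] := no x'; rewrite -Dx' mulKVg.
have dc t : exists c, d y t =1 transvection c.
  have [v v1 dv] : exists2 v, v != v0 & d y t v = v.
    have [->|] := eqVneq t s.
      by exists u => //; apply: (@g_inj s); apply: (mulgI y); rewrite -fu fd // fy.
    move/neq_negb->.
    by exists w => //; apply: (@g_inj (~~ s)); apply: (mulgI y); rewrite -fw fd // fy.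
  by apply: (inj_transvection _ _ v1 dv); [apply: (d_inj Lf fd)|apply: (d0 fd)].
have [[ct Dt] [cf Df]] := (dc true, dc false).
pose c t := if t then ct else cf.
have Dc t : d y t =1 transvection (c t) by case: t.
have fw' v : eval v = 1 -> eval (map (relabel (fun t => transvection (c t))) v) = 1.
  move=> v1; apply: (mulgI y); rewrite mulg1 -[RHS]fy -{2}(mulg1 y) -v1.
  rewrite (label_map_eval Lf fd) // fy; congr (_ * eval _); apply: eq_map => -[t x].
  by rewrite /relabel /= Dc.
have c0 t : c t = v0.
  apply/eqP/negPn/negP => ct0; have [|v v1 []] := @chiral c; first by exists t.
  exact: fw'.
apply: (edges_ind Ey) => // z t x Ez IH.
by rewrite fd // IH (d_const Lf fd t Ey Ez) Dc c0.
Qed.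
End Rigidity.
End CosetGraph.

(** * Twisted copies of a voltage cover *)

(** Multiplication by a primitive element of F_4, in the basis [v1], [v2]. *)
Definition rotv (x : klein) : klein := (x.2, x.1 (+) x.2).
(** The cyclic group of order 3: [None], [Some false] and [Some true] stand for
    0, 1 and 2. *)
Definition turn := option bool.
Definition addt (a b : turn) : turn :=
  match a, b with
  | None, _ => b
  | _, None => a
  | Some false, Some false => Some true
  | Some true, Some true => Some false
  | _, _ => None
  end.
Definition rott (a : turn) (x : klein) : klein :=
  match a with None => x | Some false => rotv x | Some true => rotv (rotv x) end.
Lemma rott_add a b x : rott (addt a b) x = rott a (rott b x).
Proof. by case: a b x => [[]|] [[]|] [[] []]. Qed.
Lemma rottD a x y : rott a (addv x y) = addv (rott a x) (rott a y).
Proof. by case: a x y => [[]|] [[] []] [[] []]. Qed.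
Lemma addtI b : injective (addt^~ b).
Proof. by case: b => [[]|] [[]|] [[]|]. Qed.
Lemma rott_inj a : injective (rott a).
Proof. by case: a => [[]|] [[] []] [[] []]. Qed.
Lemma rott0 a : rott a v0 = v0.
Proof. by case: a => [[]|]. Qed.
Lemma rott_neq0 a x : x != v0 -> rott a x != v0.
Proof. by apply: contra_neq => E; apply: (@rott_inj a); rewrite E rott0. Qed.
Lemma rott_trans (x y : klein) : x != v0 -> y != v0 -> exists a, rott a x = y.
Proof.
suff /forallP/(_ x)/forallP/(_ y) : [forall x : klein, forall y : klein,
   (x != v0) ==> (y != v0) ==> [exists a, rott a x == y]].
  by move=> /implyP H /H /implyP H' /H' /existsP[a /eqP <-]; exists a.
apply/forallP=> -[[] []]; apply/forallP => -[[] []] //=; apply/existsP;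
  by [exists None | exists (Some false) | exists (Some true)].
Qed.

(** An element of C_3 wr C_2, acting on letters: a rotation of the labels on
    either side, followed by an optional exchange of the sides. *)
Definition twist := (bool * (turn * turn))%type.
Definition amount (h : twist) s := if s then h.2.1 else h.2.2.
Definition tw (h : twist) (l : letter) : letter :=
  (l.1 (+) h.1, rott (amount h l.1) l.2).
Definition twist_comp (h k : twist) : twist :=
  (k.1 (+) h.1, (addt (amount h (true (+) k.1)) k.2.1,
                 addt (amount h (false (+) k.1)) k.2.2)).
Definition twist1 : twist := (false, (None, None)).
Lemma tw_comp h k l : tw (twist_comp h k) l = tw h (tw k l).
Proof. by case: l h k => [[] x] [[] [a b]] [[] [c d]]; rewrite /tw /= -rott_add. Qed.
Lemma twist_compI k : injective (twist_comp^~ k).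
Proof.
move: k => [e [a b]] [h1 [c d]] [h2 [c' d']]; rewrite /twist_comp /= => -[/addbI -> {h1}].
by case: e => /= /addtI-> /addtI->.
Qed.
Lemma tw1 l : tw twist1 l = l.
Proof. by case: l => [s x]; rewrite /tw /= addbF /amount if_same. Qed.

(** An edge of K_{4,4} is a pair (i, j), and [volt i j] is the voltage of this
    edge, directed from j to i.  Letters of the side [true] move i, and those of
    the side [false] move j. *)
Section VoltageGroup.
Variables (E : finGroupType) (volt : klein -> klein -> E).

Definition pos := (klein * klein)%type.
Definition shift (l : letter) (p : pos) : pos :=
  if l.1 then (addv p.1 l.2, p.2) else (p.1, addv p.2 l.2).
(** Edges of the cover are labelled by the sheet of their end over i, so that
    turning around i keeps the sheet while turning around j changes it. *)
Definition gain (l : letter) (p : pos) : E :=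
  if l.1 then (volt p.1 p.2)^-1 * volt (addv p.1 l.2) p.2 else 1.

Lemma shiftD s x y p : shift (s, addv x y) p = shift (s, y) (shift (s, x) p).
Proof. by case: s; rewrite /shift /= addvA. Qed.
Lemma gainD s x y p : gain (s, addv x y) p = gain (s, x) p * gain (s, y) (shift (s, x) p).
Proof. by case: s; rewrite /gain /shift /= ?mulg1 // -mulgA mulKVg addvA. Qed.
Lemma shift0 s p : shift (s, v0) p = p.
Proof. by case: s p => [] [[[] []] [[] []]]. Qed.
Lemma gain0 s p : gain (s, v0) p = 1.
Proof. by case: s p => [] [i j]; rewrite /gain //= addv0 mulVg. Qed.

(** The points of 18 copies of the edge set of the cover; in the copy [h] the
    letters act through [tw h]. *)
Definition point := (twist * pos * E)%type.
Definition act (l : letter) (q : point) : point :=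
  (q.1.1, shift (tw q.1.1 l) q.1.2, q.2 * gain (tw q.1.1 l) q.1.2).
Lemma actD s x y q : act (s, addv x y) q = act (s, y) (act (s, x) q).
Proof. by rewrite /act /= /tw /= rottD shiftD gainD mulgA. Qed.
Lemma actK l : involutive (act l).
Proof.
case: l => s x [[h p] k]; rewrite -actD addvv /act /tw /= rott0 shift0 gain0 mulg1 //.
Qed.
Definition label_perm s x : {perm point} := perm (inv_inj (actK (s, x))).
Lemma label_permE s x q : label_perm s x q = act (s, x) q. Proof. exact: permE. Qed.

Lemma label_permD s x y : label_perm s (addv x y) = label_perm s x * label_perm s y.
Proof. by apply/permP => q; rewrite permM !label_permE actD. Qed.
Lemma label_perm_inj s : injective (label_perm s).
Proof.
move=> x y /permP/(_ (twist1, (v0, v0), 1)); rewrite !label_permE /act !tw1 /=.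
by move/(congr1 (fun q => q.1.2)); case: s x y => [] [[] []] [[] []].
Qed.
Lemma label_perm_disj s x y : label_perm s x = label_perm (~~ s) y -> x = v0.
Proof.
move=> /permP/(_ (twist1, (v0, v0), 1)); rewrite !label_permE /act !tw1 /=.
by move/(congr1 (fun q => q.1.2)); case: s x y => [] [[] []] [[] []].
Qed.

(** Composing with a fixed twist permutes the 18 copies, and conjugation by this
    permutation applies the twist to the labels. *)
Lemma label_perm_symmetric : arc_symmetric label_permD.
Proof.
move=> s u w u0 w0.
have [a Da] := @rott_trans v1 u isT u0; have [b Db] := @rott_trans v1 w isT w0.
pose k : twist := (~~ s, (a, b)).
pose c (q : point) : point := (twist_comp q.1.1 k, q.1.2, q.2).
have c_inj : injective c.
  move=> [[h p] e] [[h' p'] e'] [/= Eh Eh1 Eh2 -> ->].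
  by rewrite (@twist_compI k h h') // /twist_comp Eh Eh1 Eh2.
have cJ t x : label_perm t x ^ (perm c_inj)^-1
    = label_perm (tw k (t, x)).1 (tw k (t, x)).2.
  rewrite /conjg invgK; apply: (mulIg (perm c_inj)); rewrite -!mulgA mulVg mulg1.
  apply/permP => q; rewrite !permM !permE /c /act /=.
  by rewrite tw_comp -[in RHS](surjective_pairing (tw k (t, x))).
exists (perm c_inj)^-1; rewrite !cJ /= Da Db; split; rewrite ?negbK //.
by move=> t x; rewrite cJ; apply: (mem_side label_permD).
Qed.

Local Notation eval := (eval label_perm).
Fixpoint walk (w : seq letter) (p : pos) : pos :=
  if w is l :: w' then walk w' (shift l p) else p.
Fixpoint gains (w : seq letter) (p : pos) : E :=
  if w is l :: w' then gain l p * gains w' (shift l p) else 1.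

Lemma eval_point w q : eval w q =
  (q.1.1, walk (map (tw q.1.1) w) q.1.2, q.2 * gains (map (tw q.1.1) w) q.1.2).
Proof.
elim: w q => [|l w IHw] [[h p] k]; first by rewrite eval_nil perm1 /= mulg1.
by rewrite eval_cons permM label_permE IHw -surjective_pairing /act /= mulgA.
Qed.

Lemma eval_eq1P w : eval w = 1 <-> forall h p,
  walk (map (tw h) w) p = p /\ gains (map (tw h) w) p = 1.
Proof.
split=> [E1 h p|E1].
  have /esym := eval_point w (h, p, 1); rewrite E1 perm1 mul1g /= => Ew.
  by split; [apply: (congr1 (fun q => q.1.2) Ew) | apply: (congr1 snd Ew)].
apply/permP => -[[h p] k]; rewrite eval_point perm1 /=.
by have [-> ->] := E1 h p; rewrite mulg1.
Qed.

Definition addp (p q : pos) : pos := (addv p.1 q.1, addv p.2 q.2).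
Lemma shift_addp l p q : shift l (addp p q) = addp p (shift l q).
Proof. by rewrite /shift /addp; case: l.1; rewrite /= -addvA. Qed.
Lemma walk_addp w p q : walk w (addp p q) = addp p (walk w q).
Proof. by elim: w q => //= l w IHw q; rewrite shift_addp IHw. Qed.

(** A walk displaces every point by the same element of F_2^2 x F_2^2. *)
Lemma walk2 w p : walk w (walk w p) = p.
Proof.
have add0p q : addp q (v0, v0) = q by case: q => i j; rewrite /addp /= !addv0.
rewrite -[p]add0p !walk_addp; pose q := walk w (v0, v0).
have -> : walk w (walk w (v0, v0)) = addp q q.
  by rewrite -/q -[q in walk w q]add0p walk_addp.
by rewrite /addp !addvv.
Qed.

Lemma walk_cat w w' p : walk (w ++ w') p = walk w' (walk w p).
Proof. by elim: w p => /=. Qed.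

Lemma edges_eval x : x \in edges label_perm -> exists w, x = eval w.
Proof.
move: x; apply: (edges_ind label_permD (group1 _)) => [|x s v _ [w ->]].
  by exists [::]; rewrite eval_nil.
exists (w ++ [:: (s, v)]).
by rewrite /eval big_cat big_seq1.
Qed.

Lemma eval_expn w n h p k : walk (map (tw h) w) p = p ->
  (eval w ^+ n) (h, p, k) = (h, p, k * gains (map (tw h) w) p ^+ n).
Proof.
move=> wp; elim: n => [|n IHn]; first by rewrite !expg0 perm1 mulg1.
by rewrite expgSr permM IHn eval_point /= wp -mulgA -expgSr.
Qed.

(** The square of an element fixes the base of the cover pointwise, so it acts
    on each fibre as a translation of the voltage group. *)
Lemma edges_exponent x : x \in edges label_perm -> x ^+ (2 * #|E|) = 1.
Proof.
case/edges_eval => w ->; rewrite expgM; apply/permP => -[[h p] k].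
have -> : eval w ^+ 2 = eval (w ++ w) by rewrite expgS expg1 /eval big_cat.
rewrite eval_expn; last by rewrite map_cat walk_cat walk2.
have -> z : z ^+ #|E| = 1 :> E by rewrite -cardsT; apply: expg_cardG; rewrite inE.
by rewrite mulg1 perm1.
Qed.

Lemma prime_edges r : prime r -> r %| #|edges label_perm| -> r %| 2 * #|E|.
Proof.
move=> pr /(Cauchy pr)[x Ex ox]; rewrite -ox order_dvdn edges_exponent //.
Qed.
End VoltageGroup.

(** * The Pauli voltages *)

Definition dot (z x : klein) : bool := (z.1 && x.1) (+) (z.2 && x.2).
Lemma dotDl y z x : dot (addv y z) x = dot y x (+) dot z x.
Proof. by case: y z x => [[] []] [[] []] [[] []]. Qed.
Lemma dotDr z x y : dot z (addv x y) = dot z x (+) dot z y.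
Proof. by case: y z x => [[] []] [[] []] [[] []]. Qed.

(** The triple (x, z, e) stands for i^e X^x Z^z, where X^x and Z^z are products of
    the Pauli matrices of two qubits; the exponent e modulo 4 is given by its two
    binary digits, high digit first. *)
Definition pauli := (klein * klein * klein)%type.
HB.instance Definition _ := Finite.on pauli.
(** Addition modulo 4 of two binary digits, plus 2 when [b] holds: moving Z^z past
    X^x costs the sign (-1)^(z.x). *)
Definition addph (b : bool) (e e' : klein) : klein :=
  (b (+) (e.1 (+) e'.1 (+) (e.2 && e'.2)), e.2 (+) e'.2).
Definition pauli_mul (a b : pauli) : pauli :=
  (addv a.1.1 b.1.1, addv a.1.2 b.1.2, addph (dot a.1.2 b.1.1) a.2 b.2).
Definition pauli_inv (a : pauli) : pauli :=
  (a.1.1, a.1.2, (dot a.1.2 a.1.1 (+) (a.2.1 (+) a.2.2), a.2.2)).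
Definition pauli_one : pauli := (v0, v0, v0).
Lemma pauli_mulA : associative pauli_mul.
Proof.
move=> [[x z] e] [[x' z'] e'] [[x'' z''] e'']; rewrite /pauli_mul /= !addvA.
congr (_, _, _); rewrite dotDl dotDr; move: (dot z x') (dot z x'') (dot z' x'').
by move: e e' e'' => [[] []] [[] []] [[] []] [] [] [].
Qed.
Lemma pauli_mul1 : left_id pauli_one pauli_mul.
Proof. by move=> [[x z] [[] []]]; rewrite /pauli_mul /= !add0v. Qed.
Lemma pauli_mulV : left_inverse pauli_one pauli_inv pauli_mul.
Proof.
by move=> [[x z] e]; rewrite /pauli_mul /= !addvv; case: (dot z x) e => [] [[] []].
Qed.
HB.instance Definition _ := Finite_isGroup.Build pauli pauli_mulA pauli_mul1 pauli_mulV.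

Lemma card_pauli : #|{: pauli}| = 64.
Proof. by rewrite !card_prod !card_bool. Qed.

(** The voltages of the edges (v1, v1), (v1, v2), (v2, v2), (v2, v1) involve X_1,
    X_2, Z_1, Z_2, so that only the commutators of opposite corners of this square are -1: they
    polarize the determinant of a two-by-two minor.  The phase is i^q, where q
    is a bilinear form over F_2, the trace of a multiple of the product of F_4;
    it yields the linear part of the quadratic form. *)
Definition pauli_volt (i j : klein) : pauli :=
  (((i == v1) && (j == v1), (i == v1) && (j == v2)),
   ((i == v2) && (j == v2), (i == v2) && (j == v1)),
   (false, (i.1 && j.1) (+) (i.1 && j.2) (+) (i.2 && j.1))).

Definition nonzero_labels : seq klein := [:: v1; v2; v3].
Definition all_labels : seq klein := v0 :: nonzero_labels.
Definition all_positions : seq pos := [seq (i, j) | i <- all_labels, j <- all_labels].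
Definition all_turns : seq turn := [:: None; Some false; Some true].
Definition all_twists : seq twist :=
  [seq (s, ab) | s <- [:: true; false],
                 ab <- [seq (a, b) | a <- all_turns, b <- all_turns]].

Lemma mem_nonzero_labels x : (x \in nonzero_labels) = (x != v0).
Proof. by case: x => [[] []]. Qed.
Lemma mem_all_positions p : p \in all_positions.
Proof. by case: p => [[[] []] [[] []]]. Qed.

Definition fixes (w : seq letter) (p : pos) : bool :=
  (walk w p == p) && (gains pauli_volt w p == 1).

Definition square (i j : klein) : seq letter :=
  [:: (true, i); (false, j); (true, i); (false, j)].
(** The word [y, z] x^2, which compares the two parts of the quadratic form.  The
    class of y in V (x) V / 2 is u (x) u, where u spans the one-dimensional
    submodule of V / 2 V; so in all twisted copies [y, z] is a sign that depends
    on the minor and on the class of z in W (x) W only.  The class of x is a pure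
    tensor, on which minors vanish, so x^2 is a sign given by the linear
    form. *)
Definition chiral_word : seq letter :=
  let y := flatten [seq square i j | i <- nonzero_labels, j <- nonzero_labels] in
  let z := square v1 v1 ++ square v2 v2 in
  let x := square v1 v3 in
  y ++ z ++ rev y ++ rev z ++ x ++ x.

Lemma chiral_word_fixes :
  all (fun h => all (fixes (map (tw h) chiral_word)) all_positions) all_twists.
Proof. by vm_compute. Qed.

(** Order exactly 2 ensures that odd powers do not vanish. *)
Definition involutive_at (w : seq letter) (p : pos) : bool :=
  [&& walk w p == p, gains pauli_volt w p != 1
    & gains pauli_volt w p * gains pauli_volt w p == 1].
Definition transvect (c d : klein) : seq letter -> seq letter :=
  map (relabel (fun s => transvection (if s then c else d))).
Lemma chiral_word_moves : all (fun c => all (fun d =>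
    ((c == v0) && (d == v0)) ||
    has (fun h => involutive_at (map (tw h) (transvect c d chiral_word)) (v0, v0))
      all_twists) all_labels) all_labels.
Proof. by vm_compute. Qed.
Lemma chiral_word_movesP c d : (c != v0) || (d != v0) ->
  exists h, involutive_at (map (tw h) (transvect c d chiral_word)) (v0, v0).
Proof.
have mem_allv x : x \in all_labels by case: x => [[] []].
have /allP/(_ _ (mem_allv c))/allP/(_ _ (mem_allv d)) := chiral_word_moves.
by rewrite -negb_and => /orP[-> //|/hasP[h _ Hh]] _; exists h.
Qed.

(** * Closed walks of length 12 *)

(** A letter of the side [true] leaves the edge listed in [starts] and arrives at
    the edge listed in [ends]; the chain of a walk is the sum of its ends minus
    the sum of its starts, so a null-homologous walk has the same edges in both
    lists. *)
Fixpoint starts (w : seq letter) (p : pos) : seq pos :=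
  if w is l :: w' then
    if l.1 then p :: starts w' (shift l p) else starts w' (shift l p)
  else [::].
Fixpoint ends (w : seq letter) (p : pos) : seq pos :=
  if w is l :: w' then
    if l.1 then shift l p :: ends w' (shift l p) else ends w' (shift l p)
  else [::].

(** No n further pairs of letters equalize the two lists.  A branch is abandoned
    when more than n edges of one list do not occur in the other, because each
    pair of letters adds one edge to each list. *)
Fixpoint no_return n (p : pos) (st en : seq pos) : bool :=
  if (n < count (predC (mem st)) en) || (n < count (predC (mem en)) st) then true
  else if n is n'.+1 then
    all (fun x => all (fun y =>
      let q := (addv p.1 x, p.2) in
      no_return n' (q.1, addv q.2 y) (p :: st) (q :: en)) nonzero_labels) nonzero_labels
  else ~~ perm_eq st en.

Lemma no_returnS n p st en : no_return n.+1 p st en =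
  if (n.+1 < count (predC (mem st)) en) || (n.+1 < count (predC (mem en)) st) then true
  else
    all (fun x => all (fun y => no_return n (addv p.1 x, addv p.2 y)
      (p :: st) ((addv p.1 x, p.2) :: en)) nonzero_labels) nonzero_labels.
Proof. by []. Qed.

(** By symmetry a walk may be assumed to begin with the labels [v1], [v1]. *)
Lemma no_return_check : all (fun x => all (fun y =>
    [|| x == v1, y == v1 |
     no_return 4 (addv v1 x, addv v1 y)
       [:: (v0, v0); (v1, v1)] [:: (v1, v0); (addv v1 x, v1)]])
    nonzero_labels) nonzero_labels.
Proof. by vm_compute. Qed.

Definition balanced (w : seq letter) (p : pos) : bool :=
  count_mem (v0, v0) (ends w p) == count_mem (v0, v0) (starts w p).
Lemma theta_word_closed : all (fun s => all (fun b => all (fun x => all (fun y =>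
    (x == y) || all (fun p =>
      fixes (theta_word s b x y) p && balanced (theta_word s b x y) p)
    all_positions) nonzero_labels) nonzero_labels) nonzero_labels) [:: true; false].
Proof. by vm_compute. Qed.

Lemma theta_word_closedP s (b x y : klein) p : b != v0 -> x != v0 -> y != v0 -> x != y ->
  [/\ walk (theta_word s b x y) p = p, gains pauli_volt (theta_word s b x y) p = 1 &
   count_mem (v0, v0) (ends (theta_word s b x y) p) =
   count_mem (v0, v0) (starts (theta_word s b x y) p)].
Proof.
rewrite -!mem_nonzero_labels => b0 x0 y0 xy.
have s2 : s \in [:: true; false] by case: (s).
have /allP/(_ s s2)/allP/(_ b b0)/allP/(_ x x0)/allP/(_ y y0) := theta_word_closed.
rewrite (negbTE xy) => /allP/(_ p (mem_all_positions p)).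
by case/andP=> [/andP[/eqP wp /eqP gp] /eqP lp].
Qed.

Lemma count_unmatched (T : eqType) (s t s' t' : seq T) :
  perm_eq (s ++ s') (t ++ t') -> count (predC (mem s)) t <= size s'.
Proof.
move=> /seq.permP/(_ (predC (mem s))); rewrite !count_cat => E.
apply: (leq_trans (leq_addr (count (predC (mem s)) t') _)); rewrite -E.
have -> : count (predC (mem s)) s = 0.
  by apply/eqP; rewrite -leqn0 leqNgt -has_count; apply/hasPn => x /= ->.
exact: count_size.
Qed.

Lemma size_starts r p : size (starts (alt true r) p) = size r.
Proof. by elim: r p => //= x r IHr p; rewrite IHr. Qed.
Lemma size_ends r p : size (ends (alt true r) p) = size r.
Proof. by elim: r p => //= x r IHr p; rewrite IHr. Qed.

Lemma perm_cons_cat (T : eqType) (x y : T) s t s' t' :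
  perm_eq (s ++ x :: s') (t ++ y :: t') = perm_eq ((x :: s) ++ s') ((y :: t) ++ t').
Proof.
have H (z : T) u v : perm_eql (u ++ z :: v) ((z :: u) ++ v).
  by apply/permPl; rewrite -cat1s perm_catCA.
by rewrite (H x) perm_sym (H y) perm_sym.
Qed.

Lemma no_returnP n p st en r : no_return n p st en -> size r = n ->
  all (fun p : klein * klein => (p.1 != v0) && (p.2 != v0)) r ->
  ~~ perm_eq (st ++ starts (alt true r) p) (en ++ ends (alt true r) p).
Proof.
move=> H rn r0; apply/negP => PE; move: H.
have c1 : count (predC (mem st)) en <= n.
  by rewrite -rn -(size_starts r p); apply: count_unmatched PE.
have c2 : count (predC (mem en)) st <= n.
  by move: (PE); rewrite perm_sym => /count_unmatched; rewrite size_ends rn.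
elim: n p st en r rn r0 PE c1 c2 => [|n IHn] p st en [|[x y] r] //.
  by rewrite /= !cats0 => _ _ -> /leq_gtF -> /leq_gtF ->.
move=> [rn] r0 PE /leq_gtF c1 /leq_gtF c2; rewrite no_returnS c1 c2.
rewrite /= in r0; have {r0} [/andP[x0 y0] r0] := andP r0.
move=> /allP/(_ x); rewrite mem_nonzero_labels => /(_ x0).
move=> /allP/(_ y); rewrite mem_nonzero_labels => /(_ y0) H.
rewrite /= perm_cons_cat in PE.
set p' := (addv p.1 x, addv p.2 y) in H.
have {}PE : perm_eq ((p :: st) ++ starts (alt true r) p')
  (((addv p.1 x, p.2) :: en) ++ ends (alt true r) p') by [].
apply: (IHn _ _ _ r rn r0 PE _ _ H).
  by rewrite -rn -(size_starts r p'); apply: count_unmatched PE.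
by move: (PE); rewrite perm_sym => /count_unmatched; rewrite size_ends rn.
Qed.

Lemma starts_addp w p q : starts w (addp p q) = map (addp p) (starts w q).
Proof. by elim: w q => //= l w IHw q; rewrite shift_addp; case: l.1; rewrite /= IHw. Qed.
Lemma ends_addp w p q : ends w (addp p q) = map (addp p) (ends w q).
Proof.
by elim: w q => //= l w IHw q; rewrite shift_addp; case: l.1; rewrite /= IHw.
Qed.

(** * The graphs *)

Section Cyclic.
Variable m : nat.
Hypothesis m_gt12 : 12 < m.
Let m_gt1 : 1 < m := leq_trans (isT : 1 < 13) m_gt12.

(** A single edge with nonzero voltage suffices to see all of the homology, since
    a walk may start at any of the 16 edges of K_{4,4}. *)
Definition height (i j : klein) : 'Z_m := ((i, j) == (v0, v0) :> pos)%:R%R.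
Definition volt (i j : klein) : pauli * 'Z_m := (pauli_volt i j, height i j).

Lemma gains_volt w p : gains volt w p = (gains pauli_volt w p, gains height w p).
Proof.
by elim: w p => //= l w IHw p; rewrite IHw /gain; case: l.1.
Qed.

Lemma gains_height w p : gains height w p =
  ((count_mem (v0, v0) (ends w p))%:R - (count_mem (v0, v0) (starts w p))%:R)%R.
Proof.
elim: w p => [|l w IHw] p /=; first by rewrite GRing.subrr.
rewrite IHw /gain; case: ifP => l1 /=; last by rewrite mul1g.
rewrite /shift l1 /height -surjective_pairing !FinRing.zmodMgE FinRing.zmodVgE !GRing.natrD.
rewrite GRing.opprD [in RHS]GRing.addrACA; congr (_ + _)%R; exact: GRing.addrC.
Qed.

(** The height counts the passages through the edge (0, 0) modulo m.  For a walk
    translated by q it counts those through the edge q of the original one, and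
    for walks shorter than m the counts are determined modulo m. *)
Lemma closed_height w : (forall p, gains height w p = 1) -> size w < m ->
  perm_eq (starts w (v0, v0)) (ends w (v0, v0)).
Proof.
move=> w1 wm; apply/allP => q _ /=; apply/eqP.
have cnt (F : seq letter -> pos -> seq pos) :
    (forall w p q, F w (addp p q) = map (addp p) (F w q)) ->
    count_mem (v0, v0) (F w q) = count_mem q (F w (v0, v0)).
  move=> FE; have {1}-> : q = addp q (v0, v0).
    by case: q => a b; rewrite /addp /= !addv0.
  rewrite FE count_map; apply: eq_count => -[a b] /=.
  apply/eqP/eqP => [E|->]; last by rewrite /addp !addvv.
  rewrite [q]surjective_pairing (addv_eq0 (congr1 fst E : addv q.1 a = v0)).
  by rewrite (addv_eq0 (congr1 snd E : addv q.2 b = v0)).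
have sz F : (forall w p, size (F w p) <= size w) -> count_mem q (F w (v0, v0)) < m.
  by move=> FE; apply: leq_ltn_trans wm; apply: leq_trans (FE w (v0, v0)); apply: count_size.
have sz_starts v p : size (starts v p) <= size v.
  by elim: v p => //= l v IHv p; case: l.1 => /=; rewrite ?ltnS // leqW.
have sz_ends v p : size (ends v p) <= size v.
  by elim: v p => //= l v IHv p; case: l.1 => /=; rewrite ?ltnS // leqW.
have := w1 q; rewrite gains_height (cnt _ ends_addp) (cnt _ starts_addp).
move/eqP; rewrite GRing.subr_eq0 => /eqP/(congr1 val) /=.
rewrite !val_Zp_nat // !modn_small ?sz //.
Qed.

Notation Eval := (eval (label_perm volt)).

Lemma eval_theta_word s (b x y : klein) : b != v0 -> x != v0 -> y != v0 -> x != y ->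
  Eval (theta_word s b x y) = 1.
Proof.
move=> b0 x0 y0 xy; apply/eval_eq1P => h p.
have -> : map (tw h) (theta_word s b x y) = theta_word (s (+) h.1)
    (rott (amount h s) b) (rott (amount h (~~ s)) x) (rott (amount h (~~ s)) y).
  by rewrite /theta_word /alt /= /tw /= -!rottD !addNb.
have [] := @theta_word_closedP (s (+) h.1) (rott (amount h s) b)
  (rott (amount h (~~ s)) x) (rott (amount h (~~ s)) y) p.
- exact: rott_neq0.
- exact: rott_neq0.
- exact: rott_neq0.
- by rewrite (inj_eq (@rott_inj _)).
by move=> wp gp lp; split; rewrite // gains_volt gp gains_height lp GRing.subrr.
Qed.

Lemma eval_short_closed s (p q : klein * klein) (r : seq (klein * klein)) : size r = 4 ->
  all (fun p : klein * klein => (p.1 != v0) && (p.2 != v0)) (p :: q :: r) ->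
  Eval (alt s (p :: q :: r)) = 1 -> p.1 = q.1 \/ p.2 = q.2.
Proof.
move=> r4 /= /and3P[/andP[p1 p2] /andP[q1 q2] r0] /eval_eq1P E.
have [a Da] := @rott_trans p.1 v1 p1 isT; have [b Db] := @rott_trans p.2 v1 p2 isT.
pose h : twist := (~~ s, if s then (a, b) else (b, a)).
pose tp (x : klein * klein) := (rott a x.1, rott b x.2).
have Dw ps : map (tw h) (alt s ps) = alt true (map tp ps).
  elim: ps => //= x ps ->; rewrite /tw /= addbN addbb addNb addbN addbb.
  by rewrite /tp /amount /h; case: (s).
have Ew x : gains volt (alt true (map tp (p :: q :: r))) x = 1.
  by rewrite -Dw; have [_ ->] := E h x.
have PE : size (alt true (map tp (p :: q :: r))) < m ->
    perm_eq (starts (alt true (map tp (p :: q :: r))) (v0, v0))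
            (ends (alt true (map tp (p :: q :: r))) (v0, v0)).
  by apply: closed_height => x; apply: (congr1 snd (etrans (esym (gains_volt _ x)) (Ew x))).
rewrite /= Da Db in PE.
have [e1|n1] := eqVneq (rott a q.1) v1; first by left; apply: (@rott_inj a); rewrite Da.
have [e2|n2] := eqVneq (rott b q.2) v1; first by right; apply: (@rott_inj b); rewrite Db.
have := rott_neq0 a q1; have := rott_neq0 b q2; rewrite -!mem_nonzero_labels => y0 x0.
have /allP/(_ _ x0)/allP/(_ _ y0) := no_return_check.
rewrite (negbTE n1) (negbTE n2) !orFb => /(@no_returnP _ _ _ _ (map tp r)).
have ra : all (fun p : klein * klein => (p.1 != v0) && (p.2 != v0)) (map tp r).
  by rewrite all_map; apply: sub_all r0 => x /andP[x1 x2]; rewrite /= !rott_neq0.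
rewrite size_map => /(_ r4 ra)/negP[].
apply: PE; move: (r) r4 => [|? [|? [|? [|? []]]]] //.
Qed.

Lemma eval_repeat n w : Eval (flatten (nseq n w)) = Eval w ^+ n.
Proof.
elim: n => [|n IHn]; first by rewrite eval_nil.
by rewrite expgS -IHn /= /eval big_cat.
Qed.

Lemma pair_expg (a : pauli) (b : 'Z_m) n : (a, b) ^+ n = (a ^+ n, (b *+ n)%R).
Proof.
elim: n => // n IHn; rewrite !expgS IHn GRing.mulrS; congr (_, _).
Qed.

Hypothesis m_odd : odd m.

Lemma expg_involutive_at w h :
  involutive_at (map (tw h) w) (v0, v0) -> Eval w ^+ m <> 1.
Proof.
case/and3P => /eqP wp g1 /eqP g2.
move/permP/(_ (h, (v0, v0), 1)); rewrite perm1 eval_expn // mul1g gains_volt pair_expg.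
move/(congr1 (fun q => q.2.1)) => /= E; case/eqP: g1; rewrite -[RHS]E.
by rewrite -(odd_double_half m) m_odd add1n expgS -mul2n expgM expgS expg1 g2 expg1n mulg1.
Qed.

(** The power m of the chiral word is a relation, as its Pauli part is trivial
    and its height is a multiple of m; after a relabelling the Pauli part has
    order 2. *)
Lemma eval_chiral (c : bool -> klein) : (exists s, c s != v0) ->
  exists2 w, Eval w = 1 & Eval (map (relabel (fun s => transvection (c s))) w) <> 1.
Proof.
move=> c0; exists (flatten (nseq m chiral_word)).
  rewrite eval_repeat; apply/permP => -[[h p] k]; rewrite perm1.
  have h_in : h \in all_twists by case: h => [[] [[[]|] [[]|]]].
  have /allP/(_ h h_in)/allP/(_ p (mem_all_positions p)) := chiral_word_fixes.
  case/andP=> /eqP wp /eqP gp.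
  rewrite eval_expn // gains_volt gp pair_expg expg1n -GRing.mulr_natr pchar_Zp //.
  by rewrite GRing.mulr0 mulg1.
have [h inv] : exists h,
    involutive_at (map (tw h) (transvect (c true) (c false) chiral_word)) (v0, v0).
  by apply: chiral_word_movesP; case: c0 => -[] ->; rewrite ?orbT.
have -> u : map (relabel (fun s => transvection (c s))) u = transvect (c true) (c false) u.
  by apply: eq_map => -[[] x].
rewrite /transvect map_flatten map_nseq eval_repeat; exact: expg_involutive_at inv.
Qed.

(** The 4-cycle through the edge (0, 0) passes it once, so the order of its value
    is a multiple of m. *)
Lemma leq_edges : m <= #|edges (label_perm volt)|.
Proof.
pose x := Eval (square v1 v1).
have Ex : x \in edges (label_perm volt) by apply: (eval_edges (@label_permD _ volt)).
apply: (@leq_trans #[x]); last by rewrite subset_leq_card // cycle_subG.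
apply: dvdn_leq; rewrite ?order_gt0 //.
have /permP/(_ (twist1, (v0, v0), 1)) := expg_order x.
rewrite perm1 eval_expn; last by [].
rewrite (eq_map tw1) map_id mul1g gains_volt pair_expg => /(congr1 (fun q => q.2.2)).
rewrite gains_height [LHS]/= => E.
have {E} : (- (#[x]%:R) = 0 :> 'Z_m)%R.
  by rewrite -GRing.mulNrn -[in LHS]GRing.sub0r; exact: E.
move/eqP; rewrite GRing.oppr_eq0 => /eqP/(congr1 val) /=.
by rewrite val_Zp_nat // => /eqP.
Qed.

Lemma solvable_coset_graph : (forall r, prime r -> r %| m -> r = 3) ->
  three_arc_regular (coset_graph (@label_permD _ volt)) ->
  solvable (graph_aut (coset_graph (@label_permD _ volt))).
Proof.
move=> m3 reg; apply: Burnside_p_a_q_b.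
have card := card_graph_aut (@label_perm_inj _ volt) (@label_perm_disj _ volt) reg.
apply: (@uniq_leq_size _ _ [:: 2; 3]) => [|r]; first exact: primes_uniq.
rewrite mem_primes card => /and3P[pr _]; rewrite Euclid_dvdM // => r_dvd.
suff : (r %| 2) || (r %| 3) by rewrite !dvdn_prime2 // !inE.
case/orP: r_dvd => [/(prime_edges pr)|]; last first.
  rewrite -[18]/(2 * 3 ^ 2)%N Euclid_dvdM // Euclid_dvdX //.
  by case/orP=> [->|/andP[->]]; rewrite ?orbT.
have r64 : r %| 2 ^ 6 -> r %| 2 by rewrite Euclid_dvdX // => /andP[].
rewrite card_prod card_pauli card_ord Zp_cast // Euclid_dvdM // => /orP[-> //|].
by rewrite Euclid_dvdM // => /orP[/r64->|/(m3 _ pr)->].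
Qed.
End Cyclic.

Theorem voltage_coset_graph (m : nat) (X := coset_graph (label_permD (@volt m))) :
  12 < m -> odd m -> (forall r, prime r -> r %| m -> r = 3) ->
  [/\ solvable_graph X, tetravalent X, three_arc_regular X & m <= #|X| ^ 2].
Proof.
move=> m12 modd m3.
pose I := @label_perm_inj _ (@volt m); pose J := @label_perm_disj _ (@volt m).
have reg : three_arc_regular X.
  apply: (coset_graph_regular I J); last exact: label_perm_symmetric.
  apply: (chiral_rigid I J).
  - exact: eval_theta_word.
  - exact: eval_short_closed.
  - exact: eval_chiral.
split=> //.
- exact: solvable_coset_graph.
- exact: coset_graph_valency.
exact: leq_trans (leq_edges _) (card_edges_le _ _).
Qed.

(** Each index is the number of vertices of the preceding graph, so the numbers of
    vertices increase. *)
Lemma nonisomorphic_subsequence (X : nat -> sgraph) : (forall k, k < #|X k|) ->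
  exists t : nat -> nat,
    forall m n, m <> n -> ~ graph_isomorphic (X (t m)) (X (t n)).
Proof.
move=> ltX; pose t n := iter n (fun k => #|X k|) 0; exists t.
have lt_size : {homo (fun n => #|X (t n)|) : m n / m < n}.
  by apply: homo_ltn ltn_trans _ => n; apply: ltX.
have size_inj : injective (fun n => #|X (t n)|) := incn_inj (leq_mono lt_size).
move=> m n mn [f fbij _]; apply/mn/size_inj; exact: bij_eq_card fbij.
Qed.

Theorem proposition6p2 :
  exists Gamma : nat -> sgraph,
    (forall n : nat,
       [/\ solvable_graph (Gamma n), tetravalent (Gamma n)
         & three_arc_regular (Gamma n)])
    /\ (forall m n : nat, m <> n -> ~ graph_isomorphic (Gamma m) (Gamma n)).
Proof.
(* The modulus exceeds (3 ^ k) ^ 2 because it is the square of the number of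
   vertices that is bounded below by the modulus. *)
have XP k : let X := coset_graph (label_permD (@volt (3 ^ (k * 2 + 3)))) in
  [/\ solvable_graph X, tetravalent X, three_arc_regular X & k < #|X|].
  have m27 : 27 <= 3 ^ (k * 2 + 3) by rewrite (@leq_exp2l 3 3) // leq_addl.
  have [|||solX valX regX leX] := @voltage_coset_graph (3 ^ (k * 2 + 3)).
  - exact: leq_trans m27.
  - by rewrite oddX orbT.
  - by move=> r pr; rewrite Euclid_dvdX // dvdn_prime2 // => /andP[/eqP].
  split=> //; apply: leq_trans (ltn_expl k (isT : 1 < 3)) _.
  rewrite -(@leq_exp2r _ _ 2) // -expnM; apply: leq_trans leX.
  by rewrite leq_exp2l // leq_addr.
have [|t tP] := @nonisomorphic_subsequence
    (fun k => coset_graph (label_permD (@volt (3 ^ (k * 2 + 3))))).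
  by move=> k; have [] := XP k.
exists (fun n => coset_graph (label_permD (@volt (3 ^ (t n * 2 + 3))))); split=> //.
by move=> n; have [] := XP (t n).
Qed.
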